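(* Let $n>0$, let $T=[2]^{<\infty}$ be colored by $\Sigma(i)=(i\bmod n)+1$, and let $A$ be a finite subset of $T$. Then for every natural $k>0$ and every map $\chi:[A]_{\mathrm{Em}}\to[k]$ there is $S\in\mathcal{S}_\Sigma(T)$ such that $\chi$ is constant on the set of elements of $[A]_{\mathrm{Em}}$ included in $S$.
   Context: $[k]=\{0,\dots,k-1\}$. $T=[2]^{<\infty}$ is the tree of finite $0$-$1$ sequences ordered by initial segment; $|t|$ is the length of $t$ and level $T(m)$ is the set of sequences of length $m$. The level coloring is $\Sigma(i)=(i\bmod n)+1$, and an element $t$ has color $\Sigma(|t|)$. A subtree $S\subseteq T$ is strong if: (1) it has a smallest element; (2) every level of $S$ is included in a level of $T$; (3) for every $s\in S$ not maximal in $S$ and every immediate successor $t$ of $s$ in $T$ there is exactly one immediate successor of $s$ in $S$ extending $t$. If the $j$-th level of $S$ lies in $T(l_j)$, the induced coloring sequence is $(\Sigma(l_j))_j$; $\mathcal{S}_\Sigma(T)$ is the set of strong subtrees of infinite height with induced coloring sequence $\Sigma$. For $s,t\in T$, $s\wedge t$ is the longest common initial segment, and for $A\subseteq T$, $A^\wedge=\{s\wedge t: s,t\in A\}$. For finite $A,B\subseteq T$, $A\,\mathrm{Em}\,B$ iff there is a bijection $f:A^\wedge\to B^\wedge$ such that for all $s,t\in A^\wedge$: (i) $s\le t\iff f(s)\le f(t)$; (ii) $|s|<|t|\iff|f(s)|<|f(t)|$; (iii) $s\in A\iff f(s)\in B$; (iv) $t(|s|)=f(t)(|f(s)|)$ whenever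 $|s|<|t|$; (v) $f(s)$ has the same color as $s$. $[A]_{\mathrm{Em}}$ is the $\mathrm{Em}$-equivalence class of $A$. *)

(* Defs.v *)
From mathcomp Require Import all_boot.
From mathcomp Require Import finmap.
Set Implicit Arguments. Unset Strict Implicit. Unset Printing Implicit Defensive.
Local Open Scope fset_scope.

(* T = [2]^{<oo} is represented by seq bool; s <= t is [prefix s t]. *)

Definition sigma (n i : nat) : nat := i %% n + 1.

Fixpoint meet (s t : seq bool) : seq bool :=
  match s, t with
  | x :: s', y :: t' => if x == y then x :: meet s' t' else [::]
  | _, _ => [::]
  end.

Definition in_meets (A : {fset seq bool}) (x : seq bool) : Prop :=
  exists s t, s \in A /\ t \in A /\ meet s t = x.

Definition Em (n : nat) (A B : {fset seq bool}) : Prop :=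
  exists f : seq bool -> seq bool,
    (forall x, in_meets A x -> in_meets B (f x)) /\
    (forall x y, in_meets A x -> in_meets A y -> f x = f y -> x = y) /\
    (forall y, in_meets B y -> exists x, in_meets A x /\ f x = y) /\
    (forall s t, in_meets A s -> in_meets A t ->
       [/\ prefix s t = prefix (f s) (f t),
           (size s < size t) = (size (f s) < size (f t)),
           (s \in A) = (f s \in B),
           (size s < size t -> nth false t (size s) = nth false (f t) (size (f s)))
         & sigma n (size (f s)) = sigma n (size s)]).

Definition sprefix (s t : seq bool) : bool := prefix s t && (s != t).

Definition lvl (S : pred (seq bool)) (s : seq bool) : nat :=
  count (fun i => S (take i s)) (iota 0 (size s)).

Definition maximal_in (S : pred (seq bool)) (s : seq bool) : Prop :=
  forall u, S u -> ~~ sprefix s u.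

Definition imm_succ (S : pred (seq bool)) (s u : seq bool) : Prop :=
  S u /\ sprefix s u /\ (forall v, S v -> sprefix s v -> ~~ sprefix v u).

Definition strong_subtree (S : pred (seq bool)) : Prop :=
  (exists r, S r /\ forall s, S s -> prefix r s) /\
  (forall s t, S s -> S t -> lvl S s = lvl S t -> size s = size t) /\
  (forall s (b : bool), S s -> ~ maximal_in S s ->
     exists! u, imm_succ S s u /\ prefix (rcons s b) u).

Definition S_Sigma (n : nat) (S : pred (seq bool)) : Prop :=
  strong_subtree S /\
  (forall j, exists s, S s /\ lvl S s = j) /\
  (forall s, S s -> sigma n (size s) = sigma n (lvl S s)).

(* Main.v *)
Require Import Defs.
From mathcomp Require Import all_boot.
From mathcomp Require Import finmap.
From Stdlib Require List.
From mathcomp Require Import boolp classical_sets filter.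
Set Implicit Arguments. Unset Strict Implicit. Unset Printing Implicit Defensive.

(* The theorem is a form of Milliken's tree theorem.  Idempotent ultrafilters in
   a minimal left ideal of the semigroup of words yield the infinite Hales-Jewett
   theorem of Carlson and Simpson.  A word over the alphabet [{ffun D -> bool}] is
   a node of the level product of [D] copies of the binary tree, so for this
   alphabet it becomes the strong Halpern-Lauchli theorem; using blocks of [n]
   letters as alphabet leaves room to prescribe the residues modulo [n] of the
   levels.  A fusion argument, applied to the last level, and induction on the
   height then give Milliken's theorem for strong subtrees of finite height with
   prescribed level colours.  Finally, the meet closure of a copy of [A] sits at
   positions depending only on [A] in a strong subtree whose levels are exactly
   those of the closure. *)

(** * Ultrafilters on a semigroup *)

Section FilterProduct.
Variables (T : Type) (op : T -> T -> T).
Hypothesis opA : associative op.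
Local Notation "x · y" := (op x y) (at level 40, left associativity).
Local Open Scope classical_set_scope.
Implicit Types (F G H u f p : set_system T) (A B X : set T).

(** On ultrafilters this is the extension of [op] to the Stone-Cech compactification. A filter
    stands for the closed set of ultrafilters containing it, so larger filters are smaller closed
    sets. *)
Definition fprod F G : set_system T :=
  fun A => F (fun s => G (fun t => A (s · t))).

Lemma fprod_filter F G : Filter F -> Filter G -> Filter (fprod F G).
Proof.
move=> FF FG; split; rewrite /fprod.
- by apply: filterE => s; apply: filterE.
- move=> A B FA FB; apply: filterS2 FA FB => s; exact: filterI.
- move=> A B AB; apply: filterS => s; apply: filterS => t; exact: AB.
Qed.

Lemma fprod_proper F G : ProperFilter F -> ProperFilter G ->
  ProperFilter (fprod F G).
Proof.
move=> FF FG; apply: Build_ProperFilter_ex; last exact: fprod_filter.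
by rewrite /fprod => A /filter_ex[s /filter_ex[t Ast]]; exists (s · t).
Qed.

Lemma fprodA F G H : fprod (fprod F G) H = fprod F (fprod G H).
Proof.
apply/funext => A; congr F; apply/funext => s; congr G; apply/funext => t.
by congr H; apply/funext => r; rewrite opA.
Qed.

Lemma fprodS F F' G G' {FF : Filter F} : F `<=` F' -> G `<=` G' ->
  fprod F G `<=` fprod F' G'.
Proof. by rewrite /fprod => FF' GG' A FA; apply/FF'; apply: filterS FA => s /GG'. Qed.

Lemma ultra_setC u A {Uu : UltraFilter u} : ~ u A -> u (~` A).
Proof. by case: (in_ultra_setVsetC A Uu). Qed.

Lemma fprod_ultra F G : UltraFilter F -> UltraFilter G -> UltraFilter (fprod F G).
Proof.
move=> FF FG; have PP := fprod_proper (@ultra_proper _ _ FF) (@ultra_proper _ _ FG).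
split=> // H PH FGH; apply/seteqP; split=> // A HA; apply: contrapT => nA.
have /FGH HnA : fprod F G (~` A).
  move: nA; rewrite /fprod => /ultra_setC; apply: filterS => s; exact: ultra_setC.
by have [x []] := filter_ex (filterI HA HnA).
Qed.

Lemma maximal_filter (Phi : set_system T -> set_system T) F0 :
    (forall F G, Filter F -> F `<=` G -> Phi F `<=` Phi G) ->
    ProperFilter F0 -> F0 `<=` Phi F0 ->
  exists F, [/\ ProperFilter F, F0 `<=` F, F `<=` Phi F &
    forall G, ProperFilter G -> F `<=` G -> G `<=` Phi G -> G = F].
Proof.
move=> PhiS PF0 F0Phi.
pose P := [set F : set_system T | F = set0 \/
  [/\ ProperFilter F, F0 `<=` F & F `<=` Phi F]].
have chainP (C : set (set_system T)) : C `<=` P -> total_on C subset ->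
    P (\bigcup_(F in C) F).
  move=> CP Ctot.
  have [[F [CF [PF F0F FPhi]]]|none] := pselect (exists F, C F /\
      [/\ ProperFilter F, F0 `<=` F & F `<=` Phi F]); last first.
    left; apply/seteqP; split=> // A [F CF FA].
    by have [F_0|] := CP F CF; [rewrite F_0 in FA|move=> ?; case: none; exists F].
  have inC G A : C G -> G A ->
      [/\ ProperFilter G, F0 `<=` G & G `<=` Phi G].
    by move=> CG GA; have [G0|//] := CP G CG; rewrite G0 in GA.
  have FU : Filter (\bigcup_(F in C) F).
    split.
    - by exists F => //; exact: filterT.
    - move=> A B [G CG GA] [H CH HB].
      have [PG _ _] := inC _ _ CG GA; have [PH _ _] := inC _ _ CH HB.
      have [GH|HG] := Ctot G H CG CH.
        by exists H => //; apply: filterI => //; exact: GH.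
      by exists G => //; apply: filterI => //; exact: HG.
    - move=> A B AB [G CG GA]; exists G => //.
      by have [PG _ _] := inC _ _ CG GA; exact: filterS GA.
  right; split.
  - apply: Build_ProperFilter_ex => A [G CG GA].
    by have [PG _ _] := inC _ _ CG GA; exact: filter_ex GA.
  - by move=> A /F0F FA; exists F.
  - move=> A [G CG GA]; have [PG _ GPhi] := inC _ _ CG GA.
    by apply: (PhiS G) (GPhi _ GA) => // B GB; exists G.
have [F [[F_0|[PF F0F FPhi]] Fmax]] := Zorn_bigcup chainP.
  exfalso; apply: (Fmax F0); last by right; split.
  by rewrite F_0; split=> // /(_ setT); apply; exact: filterT.
exists F; split=> // G PG FG GPhi; apply: contrapT => GF.
apply: (Fmax G); last by right; split=> //; exact: subset_trans FG.
by split=> // GleF; apply: GF; apply/seteqP.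
Qed.

(* Ellis' lemma, with a compact subsemigroup of the space of ultrafilters
   encoded by a filter [F0] such that [F0 `<=` fprod F0 F0]. *)
Lemma idempotent_ultrafilter F0 : ProperFilter F0 -> F0 `<=` fprod F0 F0 ->
  exists u, [/\ UltraFilter u, F0 `<=` u & fprod u u = u].
Proof.
move=> PF0 F0sub.
have [|F [PF F0F Fsub Fmax]] := @maximal_filter (fun F => fprod F F) F0 _ PF0 F0sub.
  by move=> F G FF FG; exact: fprodS.
have [u [Uu Fu]] := ultraFilterLemma PF.
(* [F] encodes a minimal closed subsemigroup S. As S u is a closed subsemigroup of S, minimality
   gives S u = S. *)
have FuF : fprod F u = F.
  apply: Fmax; first exact: fprod_proper.
    by apply: (subset_trans Fsub); exact: fprodS.
  have FuFFu : fprod F u `<=` fprod F (fprod F u).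
    by rewrite -fprodA; apply: fprodS.
  rewrite fprodA; apply: (subset_trans FuFFu). apply: fprodS => //.
  by apply: (subset_trans FuFFu); apply: fprodS.
(* [G] encodes the set of s in S with s u = u. It is nonempty since u lies in S u, and it is again a
   closed subsemigroup, so it is S and contains [u]. *)
pose D A := [set s | u (fun t => A (s · t))].
pose G := [set B | exists X A, [/\ F X, u A & X `&` D A `<=` B]].
have DI A B : D (A `&` B) = D A `&` D B.
  apply/seteqP; split=> s /=; last by case; exact: filterI.
  by move=> us; split; apply: filterS us => t [].
have PG : ProperFilter G.
  apply: Build_ProperFilter_ex.
    move=> B [X [A [FX uA XAB]]]; apply: contrapT => nB.
    have /Fu unA : F (~` A).
      rewrite -FuF /fprod; apply: filterS FX => s Xs; apply: ultra_setC => usA.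
      by apply: nB; exists s; exact: XAB.
    by have [x []] := filter_ex (filterI uA unA).
  split.
  - by exists setT, setT; split=> //; exact: filterT.
  - move=> B B' [X [A [FX uA XAB]]] [X' [A' [FX' uA' XAB']]].
    exists (X `&` X'), (A `&` A'); split; [exact: filterI|exact: filterI|].
    by rewrite DI => s [[Xs X's] [As A's]]; split; [exact: XAB|exact: XAB'].
  - move=> B B' BB' [X [A [FX uA XAB]]]; exists X, A.
    by split=> //; exact: (subset_trans XAB).
have FG : F `<=` G.
  by move=> X FX; exists X, setT; split=> //; exact: filterT.
have GD A : u A -> G (D A).
  by move=> uA; exists setT, A; split=> //; exact: filterT.
have GE B : G B -> exists X A, [/\ F X, u A & X `&` D A `<=` B] by [].
clearbody G.
have GF : G = F.
  apply: Fmax => // B /GE[X [A [FX uA XAB]]].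
  have GX : G (fun s => G (fun t => X (s · t))) .
    by apply: (fprodS FG FG); exact: Fsub.
  rewrite /fprod; apply: filterS (filterI GX (GD _ uA)) => s [GXs usA].
  apply: filterS (filterI GXs (GD _ usA)) => t [Xst utA]; apply: XAB; split=> //.
  by rewrite /D /=; apply: filterS utA => r; rewrite opA.
exists u; split=> //; first exact: (subset_trans F0F).
apply: (@max_filter _ _ Uu); first exact: fprod_proper.
by move=> A /GD; rewrite GF => /Fu.
Qed.

(* An idempotent [f] is a right identity on the closed left ideal [X f]. *)
Lemma idempotent_right_identity X f p : UltraFilter f -> UltraFilter p ->
  fprod f f = f -> fprod (globally X) f `<=` p -> fprod p f = p.
Proof.
move=> Uf Up ff Xfp; apply: (@max_filter _ _ Up); first exact: fprod_proper.
move=> A pA; apply: contrapT => npA.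
pose B := [set s | f (fun t => ~ A (s · t))].
have pB : p B.
  move: npA; rewrite /fprod => /ultra_setC; apply: filterS => s; exact: ultra_setC.
(* Idempotence of [f]: if [f]-almost all continuations of [s] lie in [B], so does [s]. Hence the
   continuations of no [s] can almost surely lie in both [A] and [B]. *)
have BfB s : f (fun t => B (s · t)) -> B s.
  rewrite /B /= -{3}ff /fprod; apply: filterS => t /=.
  by under eq_fun do rewrite -opA.
have [s [fsA fsB]] : exists s, f (fun t => A (s · t)) /\ f (fun t => B (s · t)).
  apply: contrapT => none.
  have /Xfp pn : fprod (globally X) f (~` (A `&` B)).
    move=> s _; apply: ultra_setC => fsAB; apply: none; exists s.
    by split; apply: filterS fsAB => t [].
  by have [x [ABx]] := filter_ex (filterI (filterI pA pB) pn); apply.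
by have [t []] := filter_ex (filterI fsA (BfB s fsB)).
Qed.

(* [u] is taken in a minimal left ideal, for which any idempotent [f] of that ideal
   is a right identity. *)
Lemma minimal_idempotent (t0 : T) : exists u, [/\ UltraFilter u, fprod u u = u &
  forall f, UltraFilter f -> fprod f f = f -> fprod f u = f -> fprod u f = u].
Proof.
have gS (F G : set_system T) : Filter F -> F `<=` G ->
    fprod (globally setT) F `<=` fprod (globally setT) G.
  by move=> FF FG; exact: fprodS.
have PT : ProperFilter (globally [set: T]) by exact: (@globally_properfilter _ _ t0).
have [|F [PF _ Finv Fmax]] := maximal_filter gS PT.
  by move=> A AT s _ t _; exact: AT.
have FF : F `<=` fprod F F.
  apply: (subset_trans Finv); apply: fprodS => // A AT.
  by apply: filterE => x; exact: AT.
have [u [Uu Fu uu]] := idempotent_ultrafilter PF FF.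
exists u; split=> // f Uf ff fu.
have Ff : F `<=` f.
  rewrite -fu; apply: (subset_trans Finv); apply: fprodS => // A AT.
  by apply: filterE => x; exact: AT.
have TfF : fprod (globally setT) f = F.
  apply: Fmax; first exact: fprod_proper.
    by apply: (subset_trans Finv); exact: gS.
  move=> A TA s _ t _; have := TA (s · t) I.
  by apply: filterS => r; rewrite opA.
by apply: (@idempotent_right_identity setT); rewrite // TfF.
Qed.

End FilterProduct.

(** * Variable words *)

Section UltrafilterImage.
Variables (T U : Type) (h : T -> U).
Local Open Scope classical_set_scope.

Lemma fmap_ultra (F : set_system T) : UltraFilter F -> UltraFilter (fmap h F).
Proof.
move=> UF; have PF := fmap_proper_filter h (@ultra_proper _ _ UF).
split=> // G PG FG; apply/seteqP; split=> // A GA; apply: contrapT => nA.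
have /FG GnA : fmap h F (~` A) by exact: (@ultra_setC _ F).
by have [x []] := filter_ex (filterI GA GnA).
Qed.

Lemma fmap_fprod (opT : T -> T -> T) (opU : U -> U -> U) (F G : set_system T) :
    {morph h : x y / opT x y >-> opU x y} ->
  fmap h (fprod opT F G) = fprod opU (fmap h F) (fmap h G).
Proof.
move=> hM; apply/funext => A; rewrite /fprod /fmap /=.
congr F; apply/funext => s /=; congr G; apply/funext => t /=.
by rewrite /preimage /= hM.
Qed.

Lemma ultra_fin (C : finType) (c : T -> C) (u : set_system T) :
  UltraFilter u -> exists k, u [set x | c x = k].
Proof.
move=> Uu; apply: contrapT => none.
have /filter_forall : forall k, u [set x | c x <> k].
  by move=> k; apply: (@ultra_setC _ u) => uk; apply: none; exists k.
by move=> /filter_ex[x /(_ (c x))].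
Qed.

Lemma filter_all_seq (I : eqType) (s : seq I) (P : I -> T -> Prop)
    (F : set_system T) : Filter F ->
  (forall i, i \in s -> F (P i)) -> F (fun x => forall i, i \in s -> P i x).
Proof.
move=> FF; elim: s => [_|i s IHs FP]; first by apply: filterE.
have FPs : F (fun x => forall i, i \in s -> P i x).
  by apply: IHs => j js; apply: FP; rewrite in_cons js orbT.
have FPi : F (P i) by apply: FP; rewrite mem_head.
apply: filterS (filterI FPi FPs) => x [Pi Ps] j.
by rewrite in_cons => /orP[/eqP->|/Ps].
Qed.

End UltrafilterImage.

Section CarlsonSimpson.
Variable G : finType.
Implicit Types (a : G) (s w z : seq G) (y : seq (option G)).

(* A word over [option G] is a variable word, with [None] as the variable. *)
Definition subst a y : seq G := map (odflt a) y.

Lemma subst_cat a : {morph subst a : x y / x ++ y}.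
Proof. exact: map_cat. Qed.

Lemma subst_Some a z : subst a (map Some z) = z.
Proof. by rewrite /subst -map_comp map_id. Qed.

(** Take [u] a minimal idempotent, [i] its copy on words without variable, [e] an idempotent on
    variable words with e i = e, and v = i e. Substitution is a homomorphism sending [i] to [u] and
    [e] to an idempotent f with f u = f; minimality gives u f = u, so [v] goes to [u]. *)
Lemma variable_ultrafilters : exists u v, [/\ UltraFilter u, UltraFilter v,
  fprod cat u u = u, v [set y | None \in y]%classic &
  forall a, fmap (subst a) v = u].
Proof.
have [u [Uu uu umin]] := @minimal_idempotent (seq G) cat (@catA _) [::].
pose i : set_system (seq (option G)) := fmap (map Some) u.
have Ui : UltraFilter i by exact: fmap_ultra.
have ii : fprod cat i i = i.
  by rewrite -(@fmap_fprod _ _ (map Some) cat cat) ?uu // => x y; exact: map_cat.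
have substi a : fmap (subst a) i = u.
  apply/funext => A; rewrite /i /fmap /=; congr u; apply/funext => z.
  by rewrite /preimage /= subst_Some.
pose V := [set y : seq (option G) | None \in y]%classic.
have VVV y t y' : V y -> V (y ++ t ++ y').
  by rewrite /V /= !mem_cat => ->.
pose F0 := fprod cat (globally V) i.
have F0e : (F0 `<=` fprod cat F0 F0)%classic.
  move=> A F0A y Vy; apply: (@filterE _ i) => t y' Vy'.
  by have := F0A _ (VVV _ t y' Vy); under eq_fun do rewrite -!catA;
     under [X in _ -> i X]eq_fun do rewrite -!catA.
have [|e [Ue F0sube ee]] := @idempotent_ultrafilter _ cat (@catA _) F0 _ F0e.
  apply: fprod_proper; apply: (@globally_properfilter _ _ [:: None]).
  by rewrite /V /= mem_head.
have ei : fprod cat e i = e by exact: (@idempotent_right_identity _ cat (@catA _) V).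
have eV : e V.
  by apply: F0sube => y Vy; apply: (@filterE _ i) => t; rewrite -[t]cats0; exact: VVV.
exists u, (fprod cat i e); split=> //; first exact: fprod_ultra.
  apply: (@filterE _ i) => t; apply: filterS eV => y.
  by rewrite /V /= mem_cat => ->; rewrite orbT.
move=> a; rewrite (fmap_fprod _ _ (subst_cat a)) substi.
have Ue' := fmap_ultra (subst a) Ue.
apply: umin => //; first by rewrite -(fmap_fprod _ _ (subst_cat a)) ee.
by rewrite -[X in fprod _ _ X](substi a) -(fmap_fprod _ _ (subst_cat a)) ei.
Qed.

Fixpoint before_var y : seq G :=
  if y is Some a :: y' then a :: before_var y' else [::].

Fixpoint after_var y : seq (option G) :=
  match y with
  | Some _ :: y' => after_var y'
  | None :: y' => y'
  | [::] => [::]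
  end.

Lemma subst_split_var a y : None \in y ->
  subst a y = before_var y ++ a :: subst a (after_var y).
Proof. by elim: y => //= -[b|] y IH //= /IH ->. Qed.

(** The variable word at index [j] is [None :: g j]: its leading variable is implicit, which makes
    it a left variable word. *)
Fixpoint expand (g : nat -> seq (option G)) j s : seq G :=
  if s is a :: s' then a :: subst a (g j) ++ expand g j.+1 s' else [::].

(* Infinite Hales-Jewett theorem of Carlson and Simpson.  If the ultrafilters
   [u] and [v] are as above, [y] is a [v]-random variable word and [z] a
   [u]-random word, the colour of [z ++ before_var y] is [u]-almost surely
   constant: cutting every block before its first variable yields left variable
   words. *)
Theorem carlson_simpson (C : finType) (chi : seq G -> C) :
  exists w g k, forall s, chi (w ++ expand g 0 s) = k.
Proof.
have [u [v [Uu Uv uu vV vu]]] := variable_ultrafilters.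
have /choice[kz kzP] z := ultra_fin (fun y => chi (z ++ before_var y)) Uv.
have [k uk] := ultra_fin kz Uu.
pose good z := v [set y | chi (z ++ before_var y) = k]%classic.
have ugood : u good by apply: filterS uk => z /= kzk; rewrite /good -kzk; exact: kzP.
(* Idempotence of [u] makes [best] hereditary: [u]-almost every continuation of a best word is
   best. *)
pose best z := good z /\ u (fun t => good (z ++ t)).
have ubest : u best by apply: filterI => //; move: ugood; rewrite -{1}uu.
have best_cat z : best z -> u (fun t => best (z ++ t)).
  move=> [_ uz]; apply: filterI => //; move: uz; rewrite -{1}uu /fprod.
  by apply: filterS => t; under eq_fun do rewrite catA.
have /choice[Y YP] (Z : seq (seq G)) : exists y, (forall z, z \in Z -> best z) ->
    None \in y /\ forall z, z \in Z ->
      chi (z ++ before_var y) = k /\ forall a, best (z ++ subst a y).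
  have [bZ|nb] := pselect (forall z, z \in Z -> best z); last by exists [::].
  have vZ : v (fun y => forall z, z \in Z ->
      chi (z ++ before_var y) = k /\ forall a, best (z ++ subst a y)).
    apply: filter_all_seq => z zZ; have [gz _] := bZ z zZ.
    apply: filterI => //; apply: filter_forall => a.
    by have := best_cat z (bZ z zZ); rewrite -(vu a).
  by have [y [Vy yP]] := filter_ex (filterI vV vZ); exists y.
(* [Z j] collects the finitely many words reached by all substitutions in the first [j] variable
   words, so one [Y (Z j)] serves them all. *)
pose next Z := [seq z ++ subst a (Y Z) | z <- Z, a <- enum G].
have [z0 bz0] := filter_ex ubest.
pose Z j := iter j next [:: z0].
have bZ j : forall z, z \in Z j -> best z.
  elim: j => [z|j IHj z]; first by rewrite inE => /eqP ->.
  by move=> /allpairsP[[x a] /= [xZ _ ->]]; have [_ /(_ x xZ)[_]] := YP _ IHj.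
(* Cutting each [Y (Z j)] at its first variable moves its constant head to the end of the previous
   block. *)
pose g j := after_var (Y (Z j)) ++ map Some (before_var (Y (Z j.+1))).
suff main s : forall j z, z \in Z j ->
    chi (z ++ before_var (Y (Z j)) ++ expand g j s) = k.
  exists (z0 ++ before_var (Y (Z 0))), g, k => s.
  by rewrite -catA; apply: main; rewrite inE.
elim: s => [|a s IHs] j z zZ; have [Vy /(_ z zZ)[chiz _]] := YP _ (bZ j).
  by rewrite /= cats0.
have -> : z ++ before_var (Y (Z j)) ++ expand g j (a :: s) =
    (z ++ subst a (Y (Z j))) ++ before_var (Y (Z j.+1)) ++ expand g j.+1 s.
  by rewrite (subst_split_var a Vy) /= [g j]/g subst_cat subst_Some -!catA /= -?catA.
apply: IHs; apply/allpairsP; exists (z, a); split=> //.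
by rewrite mem_enum.
Qed.

End CarlsonSimpson.

(** * Halpern-Lauchli theorem *)

Lemma size_expand (G : finType) (g : nat -> seq (option G)) j (s s' : seq G) :
  size s = size s' -> size (expand g j s) = size (expand g j s').
Proof.
by elim: s s' j => [|a s IH] [|a' s'] //= j [/IH ss']; rewrite !size_cat !size_map ss'.
Qed.

Lemma expand_rcons (G : finType) (g : nat -> seq (option G)) j s a :
  expand g j (rcons s a) = expand g j s ++ a :: subst a (g (j + size s)).
Proof.
elim: s j => [|b s IH] j /=; first by rewrite addn0 cats0.
by rewrite IH -catA addSnnS.
Qed.

Section HalpernLauchli.
Variables (n : nat) (hn : 0 < n) (D : finType).

(* The levels of the [D]-fold product tree are words over [letter]; grouping
   them in blocks of length [n] leaves room to place the variable letter at any
   residue modulo [n]. *)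
Let letter : finType := {ffun D -> bool}.
Let block : finType := {ffun 'I_n -> letter}.

Let coord (d : D) (z : seq block) : seq bool :=
  flatten [seq [seq b i d | i <- enum 'I_n] | b : block <- z].

(** The blocks in front have total length divisible by [n], so up to the initial word [w] included
    the free letter [a] lands on a level congruent to [j]. *)
Let mkblock j (a : letter) : block :=
  [ffun i : 'I_n => if i == j %% n :> nat then a else [ffun=> false]].

Let Fixpoint mkblocks j (s : seq letter) : seq block :=
  if s is a :: s' then mkblock j a :: mkblocks j.+1 s' else [::].

Local Lemma size_coord d z : size (coord d z) = n * size z.
Proof.
elim: z => [|b z IH]; first by rewrite muln0.
by rewrite /coord /= size_cat -/(coord d z) IH size_map size_enum_ord mulnS.
Qed.

Local Lemma coord_cat d z z' : coord d (z ++ z') = coord d z ++ coord d z'.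
Proof. by rewrite /coord map_cat flatten_cat. Qed.

Local Lemma size_mkblocks j s : size (mkblocks j s) = size s.
Proof. by elim: s j => //= a s IH j; rewrite IH. Qed.

Local Lemma mkblocks_rcons j s a :
  mkblocks j (rcons s a) = rcons (mkblocks j s) (mkblock (j + size s) a).
Proof. by elim: s j => [|b s IH] j /=; rewrite ?addn0 // IH addSnnS. Qed.

Local Lemma mkblock_coord j (a a' : letter) d : a d = a' d ->
  forall i, mkblock j a i d = mkblock j a' i d.
Proof. by move=> aa' i; rewrite !ffunE; case: eqP. Qed.

Local Lemma coord_subst d (b b' : block) y : (forall i, b i d = b' i d) ->
  coord d (subst b y) = coord d (subst b' y).
Proof.
move=> bb'; elim: y => //= -[c|] y IH; rewrite /coord /= -!/(coord d _) IH //.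
by congr (_ ++ _); apply: eq_map.
Qed.

Local Lemma coord_expand d g j (s s' : seq letter) :
    [seq a d | a : letter <- s] = [seq a d | a : letter <- s'] ->
  coord d (expand g j (mkblocks j s)) = coord d (expand g j (mkblocks j s')).
Proof.
elim: s s' j => [|a s IH] [|a' s'] //= j [/(mkblock_coord j) aa' /IH ss'].
rewrite -(cat1s (mkblock j a)) -(cat1s (mkblock j a')) !coord_cat ss'
  (coord_subst _ aa').
by congr (_ ++ _); rewrite /coord /= !cats0; exact: eq_map.
Qed.

(** A node of level [j] ends with [j %% n] letters [false], exactly the filler of the next block
    before its free letter, so its successors extend it by the letter chosen there. *)
Local Lemma prefix_mkblock d j (a : letter) :
  prefix (rcons (nseq (j %% n) false) (a d)) (coord d [:: mkblock j a]).
Proof.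
have jn : j %% n < n by rewrite ltn_mod.
have -> : coord d [:: mkblock j a] = [seq (i == j %% n) && a d | i <- iota 0 n].
  rewrite /coord /= cats0 -val_enum_ord -map_comp; apply: eq_map => i /=.
  by rewrite ffunE; case: eqP => //=; rewrite ffunE.
move: (j %% n) jn => i i_n.
have -> : iota 0 n = iota 0 i ++ i :: iota i.+1 (n - i.+1).
  by rewrite -[in LHS](subnKC i_n) addSnnS iotaD.
rewrite map_cat /= eqxx /= -cat_rcons.
have -> : [seq (k == i) && a d | k <- iota 0 i] = nseq i false.
  apply: (@eq_from_nth _ false); first by rewrite size_map size_iota size_nseq.
  move=> k; rewrite size_map size_iota => ki.
  by rewrite (nth_map 0) ?size_iota // nth_iota // nth_nseq ki add0n ltn_eqF.
exact: prefix_prefix.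
Qed.

Theorem halpern_lauchli (C : finType) (chi : {ffun D -> seq bool} -> C) :
  exists (psi : D -> seq bool -> seq bool) (kappa : nat -> C), [/\
    forall d d' s s', size s = size s' -> size (psi d s) = size (psi d' s'),
    forall d s b, prefix (rcons (psi d s) b) (psi d (rcons s b)),
    forall d s, size (psi d s) = size s %[mod n] &
    forall (t : {ffun D -> seq bool}) l, (forall d, size (t d) = l) ->
      chi [ffun d => psi d (t d)] = kappa (l %% n)].
Proof.
(* A value of [chi'] records the colours for all [n] paddings, so constancy of [chi'] yields one
   colour of [chi] per residue. *)
pose chi' (z : seq block) := [ffun i : 'I_n =>
  chi [ffun d => coord d z ++ nseq i false]].
have [w [g [k kP]]] := carlson_simpson chi'.
pose pt d (s : seq letter) :=
  coord d (w ++ expand g 0 (mkblocks 0 s)) ++ nseq (size s %% n) false.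
(* Coordinate [d] of [pt] reads only the coordinates [d] of the letters, so [psi d] may copy its
   argument into all coordinates. *)
pose const (b : bool) : letter := [ffun=> b].
have pt_coord d s s' : [seq a d | a : letter <- s] = [seq a d | a : letter <- s'] ->
    pt d s = pt d s'.
  move=> ss'; rewrite /pt !coord_cat (coord_expand _ _ ss').
  by have := congr1 size ss'; rewrite !size_map => ->.
have const_coord d s : [seq a d | a : letter <- map const s] = s.
  by rewrite -map_comp -[RHS]map_id; apply: eq_map => b /=; rewrite ffunE.
exists (fun d s => pt d (map const s)).
exists (fun i => k (Ordinal (ltn_pmod i hn))); split.
- move=> d d' s s' ss'; rewrite /pt !size_cat !size_coord !size_cat !size_nseq.
  rewrite !size_map ss'; congr (_ * (_ + _) + _); apply: size_expand.
  by rewrite !size_mkblocks !size_map.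
- move=> d s b; rewrite map_rcons /pt mkblocks_rcons expand_rcons size_rcons.
  rewrite !size_map add0n -(cat1s (mkblock _ _)) !coord_cat -!catA rcons_cat.
  rewrite prefix_catr // eqxx /= rcons_cat prefix_catr // eqxx /=.
  apply: (@prefix_trans _ (coord d [:: mkblock (size s) (const b)])).
    by have := prefix_mkblock d (size s) (const b); rewrite ffunE.
  by rewrite /coord /= cats0 prefix_prefix.
- move=> d s; rewrite /pt size_cat size_coord size_nseq size_map.
  by rewrite mulnC modnMDl modn_mod.
- move=> t l tl.
  pose s : seq letter := [seq [ffun d => nth false (t d) i] | i <- iota 0 l].
  have sE d : [seq a d | a : letter <- s] = t d.
    rewrite -map_comp -(tl d) -[RHS](mkseq_nth false); apply: eq_map => i /=.
    by rewrite ffunE.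
  have sl : size s = l by rewrite size_map size_iota.
  have -> : [ffun d => pt d (map const (t d))] = [ffun d => pt d s].
    by apply/ffunP => d; rewrite !ffunE; apply: pt_coord; rewrite sE const_coord.
  rewrite -(kP (mkblocks 0 s)) ffunE; congr chi; apply/ffunP => d.
  by rewrite !ffunE /pt sl /= modn_mod.
Qed.

End HalpernLauchli.

(** * Strong embeddings *)

Lemma prefix_rcons_nth (s t : seq bool) : prefix s t -> size s < size t ->
  prefix (rcons s (nth false t (size s))) t.
Proof.
case/prefixP=> -[|b u] ->; first by rewrite cats0 ltnn.
by rewrite nth_cat ltnn subnn /= -cat_rcons prefix_prefix.
Qed.

Lemma prefix_eq_size (s t : seq bool) : prefix s t -> size t <= size s -> s = t.
Proof. by rewrite prefixE => /eqP st ts; rewrite -st take_oversize. Qed.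

Lemma prefix_rconsE (s t : seq bool) b :
  prefix s (rcons t b) -> s = rcons t b \/ prefix s t.
Proof.
move=> st; case: (ltnP (size t) (size s)) => ts.
  by left; apply: prefix_eq_size; rewrite // size_rcons.
by right; move: st; rewrite !prefixE -cats1 takel_cat.
Qed.

Lemma prefix_rcons_inj (r t : seq bool) b b' :
  prefix (rcons r b) t -> prefix (rcons r b') t -> b = b'.
Proof.
rewrite !prefixE !size_rcons => /eqP -> /eqP.
by move/rcons_inj => [].
Qed.

Lemma meetC (s t : seq bool) : meet s t = meet t s.
Proof.
elim: s t => [|x s IH] [|y t] //=; rewrite (eq_sym y).
by case: eqP => // ->; rewrite IH.
Qed.

Lemma meet_prefix (s t : seq bool) : prefix s t -> meet s t = s.
Proof.
by elim: s t => [|x s IH] [|y t] //= /andP[/eqP <- /IH ->]; rewrite eqxx.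
Qed.

Lemma meet_split (r s t : seq bool) b :
  prefix (rcons r b) s -> prefix (rcons r (~~ b)) t -> meet s t = r.
Proof.
elim: r s t => [|x r IH] [|y s] [|z t] //=.
  by move=> /andP[/eqP <- _] /andP[/eqP <- _]; case: b.
by move=> /andP[/eqP <- rs] /andP[/eqP <- rt]; rewrite eqxx (IH s t).
Qed.

Variant meet_spec (s t : seq bool) : Prop :=
| MeetLeft of prefix s t
| MeetRight of prefix t s
| MeetSplit r b of prefix (rcons r b) s & prefix (rcons r (~~ b)) t.

Lemma meetP s t : meet_spec s t.
Proof.
elim: s t => [|x s IH] [|y t]; try by [exact: MeetLeft|exact: MeetRight].
have [<-|/eqP xy] := eqVneq x y.
  case: (IH t) => [st|ts|r b rs rt].
  - by apply: MeetLeft; rewrite /= eqxx.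
  - by apply: MeetRight; rewrite /= eqxx.
  - by apply: (@MeetSplit _ _ (x :: r) b); rewrite /= eqxx.
have -> : y = ~~ x by case: x y xy => -[].
by apply: (@MeetSplit _ _ [::] x); rewrite /= eqxx prefix0s.
Qed.

Lemma meet_prefixl (s t : seq bool) : prefix (meet s t) s.
Proof.
by elim: s t => [|x s IH] [|y t] //=; case: eqP => //= _; rewrite eqxx IH.
Qed.

Lemma meet_prefixr (s t : seq bool) : prefix (meet s t) t.
Proof. by rewrite meetC meet_prefixl. Qed.

(* [s] with its last letter kept and the rest mapped by [e]: the immediate
   successor that [e s] has to extend. *)
Definition succ_of (e : seq bool -> seq bool) (s : seq bool) : seq bool :=
  if s is x :: s' then rcons (e (belast x s')) (last x s') else [::].

Lemma succ_of_rcons e s b : succ_of e (rcons s b) = rcons (e s) b.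
Proof. by case: s => //= x s; rewrite belast_rcons last_rcons. Qed.

Section StrongEmbedding.
Variable n : nat.
Implicit Types (m : nat) (c : nat -> nat) (e phi psi : seq bool -> seq bool).
Implicit Types (s t : seq bool).

(* [e] enumerates a strong subtree of height [m], all of whose nodes of level
   [i] lie at a level of the full tree congruent to [c i] modulo [n]. *)
Definition strong_below m c e := forall s, size s < m ->
  [/\ prefix (succ_of e s) (e s), size (e s) = c (size s) %[mod n] &
      forall t, size t = size s -> size (e t) = size (e s)].

Definition strong phi := forall m, strong_below m id phi.

Lemma strong_belowW m m' c e :
  m <= m' -> strong_below m' c e -> strong_below m c e.
Proof. by move=> mm' se s sm; apply: se; exact: leq_trans mm'. Qed.

Lemma strong_id : strong id.
Proof.
move=> m s _; split=> //; elim/last_ind: s => [|s b _]; first exact: prefix_refl.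
by rewrite succ_of_rcons prefix_refl.
Qed.

Section Below.
Variables (m : nat) (c : nat -> nat) (e : seq bool -> seq bool).
Hypothesis se : strong_below m c e.

Lemma strong_rcons s b : size s < m.-1 -> prefix (rcons (e s) b) (e (rcons s b)).
Proof.
move=> sm; rewrite -succ_of_rcons.
by have [] := @se (rcons s b); rewrite // size_rcons -ltn_predRL.
Qed.

Lemma strong_size s t : size s < m -> size s = size t -> size (e s) = size (e t).
Proof. by move=> sm st; have [_ _ /(_ t (esym st)) ->] := se sm. Qed.

Lemma strong_prefix s t : prefix s t -> size t < m -> prefix (e s) (e t).
Proof.
elim/last_ind: t => [|t b IH]; first by case: s => // _ _; exact: prefix_refl.
rewrite size_rcons => stb tm; have [->|st] := prefix_rconsE stb.
  exact: prefix_refl.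
apply: prefix_trans (IH st (ltnW tm)) _.
apply: prefix_trans (prefix_rcons _ b) _; apply: strong_rcons.
by rewrite ltn_predRL.
Qed.

Lemma strong_prefix_rcons s b t : size t < m ->
  prefix (rcons s b) t -> prefix (rcons (e s) b) (e t).
Proof.
move=> tm st; apply: prefix_trans (strong_prefix st tm).
apply: strong_rcons; rewrite ltn_predRL; apply: leq_ltn_trans tm.
by rewrite -(size_rcons s b) size_prefix.
Qed.

Lemma strong_ltn s t : size s < size t -> size t < m -> size (e s) < size (e t).
Proof.
move=> st tm.
have -> : size (e s) = size (e (take (size s) t)).
  by apply: strong_size; rewrite ?size_take ?st // (ltn_trans st).
have := strong_prefix_rcons tm (prefix_rcons_nth (prefix_take t (size s)) _).
by move=> /(_ _)/size_prefix; rewrite size_rcons; apply; rewrite size_take st.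
Qed.

Lemma strong_leq s t : size s <= size t -> size t < m -> size (e s) <= size (e t).
Proof.
rewrite leq_eqVlt => /predU1P[st|st] tm; last exact/ltnW/strong_ltn.
by rewrite (strong_size _ st) // st.
Qed.

Lemma strong_nth s t : size s < size t -> size t < m ->
  nth false (e t) (size (e s)) = nth false t (size s).
Proof.
move=> st tm; pose r := take (size s) t.
have sr : size r = size s by rewrite size_take st.
have rt : prefix (rcons r (nth false t (size r))) t.
  by apply: prefix_rcons_nth; rewrite ?prefix_take ?sr.
have /prefixP[u ->] := strong_prefix_rcons tm rt.
have -> : size (e s) = size (e r).
  by apply: strong_size; rewrite ?sr // (ltn_trans st).
by rewrite nth_cat size_rcons leqnn nth_rcons ltnn eqxx sr.
Qed.

Lemma strong_meet s t : size s < m -> size t < m ->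
  meet (e s) (e t) = e (meet s t).
Proof.
move=> sm tm; have [st|ts|r b rs rt] := meetP s t.
- by rewrite !meet_prefix // strong_prefix.
- by rewrite meetC [in RHS]meetC !meet_prefix // strong_prefix.
- by rewrite (meet_split rs rt) (@meet_split (e r) _ _ b) // strong_prefix_rcons.
Qed.

Lemma strong_prefixE s t : size s < m -> size t < m ->
  prefix (e s) (e t) = prefix s t.
Proof.
move=> sm tm; apply/idP/idP => [est|st]; last exact: strong_prefix.
have [//|ts|r b rs rt] := meetP s t.
  case: (ltnP (size t) (size s)) => [lts|st]; last first.
    by rewrite (prefix_eq_size ts st) prefix_refl.
  by have := size_prefix est; rewrite leqNgt strong_ltn.
have ers := prefix_trans (strong_prefix_rcons sm rs) est.
by have := prefix_rcons_inj ers (strong_prefix_rcons tm rt); case: (b).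
Qed.

Lemma strong_inj s t : size s < m -> size t < m -> e s = e t -> s = t.
Proof.
move=> sm tm est; apply: prefix_eq_size.
  by rewrite -strong_prefixE // est prefix_refl.
by apply: size_prefix; rewrite -strong_prefixE // est prefix_refl.
Qed.

End Below.

Lemma strong_comp m c phi e : strong phi -> strong_below m c e ->
  strong_below m c (phi \o e).
Proof.
move=> sphi se s sm; have [pes ces zes] := se s sm; split=> /=.
- elim/last_ind: s sm pes {ces zes} => [|s b _] sm; rewrite ?prefix0s // !succ_of_rcons.
  exact: (strong_prefix_rcons (sphi _) (ltnSn _)).
- by have [_ -> _] := sphi _ (e s) (ltnSn _).
- by move=> t ts; apply: (strong_size (sphi _) (ltnSn _)); exact: zes.
Qed.

Lemma strong_comp_strong phi psi : strong phi -> strong psi -> strong (phi \o psi).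
Proof. by move=> sphi spsi m; exact: strong_comp. Qed.

Lemma eq_strong_below m c e e' : (forall s, size s < m -> e s = e' s) ->
  strong_below m c e -> strong_below m c e'.
Proof.
move=> ee' se s sm; have [pes ces zes] := se s sm.
split; rewrite -?ee' //; last by move=> t ts; rewrite -ee' ?ts // zes.
elim/last_ind: s sm pes {ces zes} => [|s b _] sm; rewrite ?prefix0s // !succ_of_rcons.
by rewrite -ee' //; apply: leq_trans sm; rewrite size_rcons.
Qed.

End StrongEmbedding.

(** * Milliken theorem *)

Lemma finite_restrictions (S T : eqType) (t0 : T) (ds : seq S) (rs : seq T) :
  exists E : seq (S -> T), forall f, (forall d, d \in ds -> f d \in rs) ->
    exists2 g, List.In g E & forall d, d \in ds -> f d = g d.
Proof.
elim: ds => [|d ds [E EP]].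
  by exists [:: fun=> t0] => f _; exists (fun=> t0) => //; left.
exists (List.flat_map (fun r =>
  List.map (fun g x => if x == d then r else g x) E) rs) => f fP.
have [x xds|g gE fg] := EP f; first by apply: fP; rewrite in_cons xds orbT.
exists (fun x => if x == d then f d else g x).
  apply/List.in_flat_map; exists (f d); split; last first.
    by apply/List.in_map_iff; exists g.
  have : f d \in rs by apply: fP; rewrite mem_head.
  by elim: (rs) => // r rs' IH; rewrite in_cons => /predU1P[->|/IH]; [left|right].
by move=> x; rewrite in_cons; case: eqP => [-> _|_ /fg].
Qed.

Lemma finitely_many_short (T : finType) m :
  exists L : seq (seq T), forall s, size s < m -> s \in L.
Proof.
exists (flatten [seq [seq val t | t <- enum {: i.-tuple T}] | i <- iota 0 m]).
move=> s sm; apply/flatten_mapP; exists (size s); first by rewrite mem_iota.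
by apply/mapP; exists (in_tuple s); rewrite ?mem_enum.
Qed.

Section Milliken.
Variables (n : nat) (hn : 0 < n) (C : finType).
Implicit Types (e phi psi : seq bool -> seq bool) (s t : seq bool).
Implicit Types (m J : nat) (c : nat -> nat).

Definition agree_below m e e' := forall s, size s < m -> e s = e' s.

(** The subtrees above the nodes of level [J] are the factors of the level product. [psi] fixes
    everything below [J] and acts above node [d] by the embedding that [halpern_lauchli] gives to
    [d]. Levels there are counted from [J], whence [l - J]. *)
Lemma halpern_lauchli_level J (chi : (seq bool -> seq bool) -> C) :
    (forall h h', (forall s, size s = J -> h s = h' s) -> chi h = chi h') ->
  exists psi, [/\ strong n psi, forall s, size s < J -> psi s = s &
    exists kappa : nat -> C, forall h l,
      (forall s, size s = J -> prefix s (h s) /\ size (h s) = l) ->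
      chi (psi \o h) = kappa ((l - J) %% n)].
Proof.
move=> chi_ext.
pose D : finType := J.-tuple bool.
pose node s : D := insubd [tuple of nseq J false] s.
have nodeK s : size s = J -> val (node s) = s.
  by move=> sJ; rewrite val_insubd sJ eqxx.
pose chi' (t : {ffun D -> seq bool}) := chi (fun s => s ++ t (node s)).
have [f [kappa [fsize fsucc fmod fchi]]] := halpern_lauchli hn chi'.
pose psi s := if size s < J then s else take J s ++ f (node (take J s)) (drop J s).
exists psi; split; first 1 last.
- by move=> s sJ; rewrite /psi sJ.
- exists kappa => h l hP.
  pose t := [ffun d : D => drop J (h (val d))].
  rewrite -(fchi t) => [|d]; last first.
    by rewrite ffunE size_drop; have [_ ->] := hP (val d) (size_tuple d).
  apply: chi_ext => s sJ /=; rewrite !ffunE nodeK //.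
  have [/prefixP[u hE] _] := hP s sJ.
  by rewrite /psi hE size_cat sJ ltnNge leq_addr /= take_size_cat // drop_size_cat.
- move=> m s _; split.
  + elim/last_ind: s => [|s b _]; first exact: prefix0s.
    rewrite succ_of_rcons /psi size_rcons; case: (ltngtP (size s).+1 J) => sJ.
    * exact: prefix_refl.
    * rewrite -!cats1 takel_cat // drop_cat.
      move: sJ; rewrite ltnS leq_eqVlt => /predU1P[sJ|sJ].
        rewrite sJ ltnn subnn drop0 drop_oversize ?sJ //.
        by rewrite !cats1 rcons_cat prefix_catr // eqxx /= (fsucc _ [::]).
      by rewrite sJ !cats1 rcons_cat prefix_catr // eqxx /= fsucc.
    * by rewrite -sJ take_oversize ?size_rcons // prefix_prefix.
  + rewrite /psi /=; case: ltnP => // Js.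
    by rewrite size_cat size_takel // -modnDmr fmod modnDmr size_drop subnKC.
  + move=> t ts; rewrite /psi ts; case: ltnP => // Js.
    rewrite !size_cat !size_takel ?ts //; congr (_ + _); apply: fsize.
    by rewrite !size_drop ts.
Qed.

(* The level of the full tree above which the nodes of the last level of a strong
   subtree of height [m.+1] extending [e] are chosen freely. *)
Definition top_level m e := if m is m'.+1 then (size (e (nseq m' false))).+1 else 0.

Section TopLevel.
Variables (m : nat) (c : nat -> nat) (e : seq bool -> seq bool).
Hypothesis se : strong_below n m c e.

Lemma size_succ_of s : size s = m -> size (succ_of e s) = top_level m e.
Proof.
case: m se => [|m'] se'; first by case: s.
elim/last_ind: s => // s b _; rewrite size_rcons => -[sm].
rewrite succ_of_rcons size_rcons /=; congr _.+1.
by apply: (strong_size se'); rewrite ?size_nseq ?sm.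
Qed.

Lemma size_below_top s : size s < m -> size (e s) < top_level m e.
Proof.
case: m se => // m' se' sm; rewrite /= ltnS.
by apply: (strong_leq se'); rewrite size_nseq.
Qed.

Lemma succ_of_inj s t : size s = m -> size t = m ->
  succ_of e s = succ_of e t -> s = t.
Proof.
elim/last_ind: s => [|s b _] sm; elim/last_ind: t => [|t b' _] tm //.
- by move: tm; rewrite -sm size_rcons.
- by move: tm; rewrite -sm size_rcons.
rewrite !succ_of_rcons => /rcons_inj[est ->]; congr rcons.
apply: (strong_inj se) est; first by rewrite -sm size_rcons.
by rewrite -tm size_rcons.
Qed.

End TopLevel.

Lemma eq_top_level m e e' : agree_below m e e' -> top_level m e = top_level m e'.
Proof. by case: m => //= m' ->; rewrite ?size_nseq. Qed.

Lemma eq_succ_of m e e' s : agree_below m e e' -> size s <= m ->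
  succ_of e s = succ_of e' s.
Proof.
elim/last_ind: s => // s b _ ee'; rewrite size_rcons => sm.
by rewrite !succ_of_rcons ee'.
Qed.

Section Fusion.
Variables (m : nat) (c : nat -> nat).

Definition depends_below_on k (chi : (seq bool -> seq bool) -> C) :=
  forall e e', agree_below k e e' -> chi e = chi e'.

Definition settles chi e0 psi := forall e e',
  strong_below n m.+1 c e -> strong_below n m.+1 c e' ->
  agree_below m e e0 -> agree_below m e' e0 -> chi (psi \o e) = chi (psi \o e') :> C.

(** Extending [e0] by one level means choosing nodes, all on one level, above its successors on
    level [J]. [halpern_lauchli_level] makes the colour depend only on the residue of that level,
    and [c] prescribes this residue. *)
Lemma settle_one J chi e0 : depends_below_on m.+1 chi -> exists psi,
  [/\ strong n psi, forall s, size s < J -> psi s = s &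
      top_level m e0 = J -> settles chi e0 psi].
Proof.
move=> chi_ext.
have [[/[dup] se0 _ topJ]|none] := pselect (strong_below n m c e0 /\ top_level m e0 = J);
  last first.
  exists id; split=> //; first exact: strong_id.
  move=> topJ e e' se _ ee0; case: none; split=> //.
  apply: eq_strong_below ee0 _; exact: strong_belowW se.
pose ext (h : seq bool -> seq bool) s := if size s < m then e0 s else h (succ_of e0 s).
pose chi' h := chi (ext h).
have [h h' hh'|psi [spsi psiJ [kappa psiP]]] := @halpern_lauchli_level J chi'.
  apply: chi_ext => s sm; rewrite /ext; case: ltnP => // ms; apply: hh'.
  by rewrite (size_succ_of se0) //; apply/eqP; rewrite eqn_leq ms -ltnS sm.
exists psi; split=> // _.
have mS : size (nseq m false) < m.+1 by rewrite size_nseq.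
have topE e : strong_below n m.+1 c e -> agree_below m e e0 ->
    J <= size (e (nseq m false)).
  move=> se ee0; have [/size_prefix + _ _] := se _ mS.
  by rewrite (eq_succ_of ee0) ?size_nseq // (size_succ_of se0) ?size_nseq // topJ.
suff main e : strong_below n m.+1 c e -> agree_below m e e0 ->
    chi (psi \o e) = kappa ((size (e (nseq m false)) - J) %% n).
  move=> e e' se se' ee0 e'0; rewrite !main //; congr kappa.
  apply/eqP; rewrite -(eqn_modDr J) !subnK ?topE //; apply/eqP.
  by have [_ -> _] := se _ mS; have [_ -> _] := se' _ mS.
move=> se ee0; set l := size _.
(* The last level of [e] is read off the successors; the other nodes of level [J] are padded up to
   the common level [l]. *)
pose h x := if [pick s : m.-tuple bool | succ_of e0 s == x] is Some s then e s
            else x ++ nseq (l - J) false.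
have hE s : size s = m -> h (succ_of e0 s) = e s.
  move=> sm; rewrite /h; case: pickP => [s' /eqP ss'|none'].
    by congr e; apply: (succ_of_inj se0) ss'; rewrite ?size_tuple.
  by have := none' (Tuple (introT eqP sm)); rewrite /= eqxx.
have Jl : J <= l by exact: topE.
rewrite -(psiP h l) => [|x xJ].
  apply: chi_ext => s sm; rewrite /ext /=; case: ltnP => ms.
    by rewrite ee0 // psiJ // -topJ (size_below_top se0).
  by rewrite hE //; apply/eqP; rewrite eqn_leq ms -ltnS sm.
rewrite /h; case: pickP => [s /eqP <-|_]; last first.
  by rewrite prefix_prefix size_cat xJ size_nseq subnKC.
have sm : size s = m by rewrite size_tuple.
have [|pes _ _] := se s; first by rewrite sm.
split; first by rewrite -(eq_succ_of ee0) ?sm.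
by apply: (strong_size se); rewrite ?sm ?size_nseq.
Qed.

(** Up to agreement below [m], finitely many [e0] have top level [J], as their values are shorter
    than [J]. They are settled in turn; each new embedding fixes the nodes below [J], so it
    preserves agreement with those settled before. *)
Lemma settle_level J chi : depends_below_on m.+1 chi -> exists psi,
  [/\ strong n psi, forall s, size s < J -> psi s = s &
      forall e0, strong_below n m c e0 -> top_level m e0 = J -> settles chi e0 psi].
Proof.
move=> chi_ext; have [ds dsP] := finitely_many_short bool m.
have [rs rsP] := finitely_many_short bool J.
have [E EP] := finite_restrictions [::] [seq s <- ds | size s < m] rs.
suff [psi [spsi psiJ psiE]] : exists psi, [/\ strong n psi,
    forall s, size s < J -> psi s = s &
    forall e0, List.In e0 E -> top_level m e0 = J -> settles chi e0 psi].
  exists psi; split=> // e0 se0 topJ.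
  have [s|e1 e1E e01] := EP e0.
    by rewrite mem_filter => /andP[sm _]; apply: rsP; rewrite -topJ (size_below_top se0).
  have e0e1 : agree_below m e0 e1 by move=> s sm; apply: e01; rewrite mem_filter sm dsP.
  move=> e e' se se' ee0 ee'0; apply: (psiE e1 e1E _ e e' se se').
  - by rewrite -(eq_top_level e0e1).
  - by move=> s sm; rewrite ee0 // e0e1.
  - by move=> s sm; rewrite ee'0 // e0e1.
elim: E {EP} => [|e1 E [psi [spsi psiJ psiE]]].
  by exists id; split=> //; exact: strong_id.
have [|th [sth thJ thP]] := @settle_one J (fun e => chi (psi \o e)) e1.
  by move=> e e' ee'; apply: chi_ext => s sm; rewrite /= ee'.
exists (psi \o th); split; first exact: strong_comp_strong.
  by move=> s sJ /=; rewrite thJ // psiJ.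
move=> e0 /= [<-|e0E] topJ e e' se se' ee0 ee'0; first exact: thP.
have stay e2 : strong_below n m.+1 c e2 -> agree_below m e2 e0 ->
    agree_below m (th \o e2) e0.
  move=> se2 e20 s sm /=; rewrite e20 // thJ // -e20 // -topJ -(eq_top_level e20).
  by apply: (size_below_top (strong_belowW (leqnSn m) se2)).
apply: (psiE e0 e0E topJ (th \o e) (th \o e')); try exact: stay; exact: strong_comp.
Qed.

(* [phi] is the limit of [phi_(J+1) = phi_J \o psi_J], where [psi_J] is the identity
   below level [J] and makes the colour of [e] depend only on its restriction to
   levels below [m], whenever this restriction has top level [J]. *)
Lemma fusion chi : depends_below_on m.+1 chi -> exists phi, strong n phi /\
  forall e e', strong_below n m.+1 c e -> strong_below n m.+1 c e' ->
    agree_below m e e' -> chi (phi \o e) = chi (phi \o e').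
Proof.
move=> chi_ext.
have /choice[Psi PsiP] (x : nat * (seq bool -> seq bool)) : exists psi,
    [/\ strong n psi, forall s, size s < x.1 -> psi s = s &
    forall e0, strong_below n m c e0 -> top_level m e0 = x.1 ->
      settles (fun e => chi (x.2 \o e)) e0 psi].
  by apply: settle_level => e e' ee'; apply: chi_ext => s sm; rewrite /= ee'.
pose fix phi J := if J is J'.+1 then phi J' \o Psi (J', phi J') else id.
have sphi J : strong n (phi J).
  elim: J => [|J IH] /=; first exact: strong_id.
  by apply: strong_comp_strong => //; have [] := PsiP (J, phi J).
(* Later stages factor through [phi J] by a map fixing the nodes below [J]; hence [phi J s] is
   stable once [J] exceeds [size s]. *)
have phiD J d : exists th, [/\ strong n th, forall s, size s < J -> th s = s &
    phi (J + d) = phi J \o th].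
  elim: d => [|d [th [sth thJ phiE]]].
    by exists id; rewrite addn0; split=> //; exact: strong_id.
  have [sPsi PsiJ _] := PsiP (J + d, phi (J + d)).
  exists (th \o Psi (J + d, phi (J + d))); split.
  - exact: strong_comp_strong.
  - by move=> s sJ /=; rewrite PsiJ ?thJ //; apply: leq_trans sJ (leq_addr _ _).
  - by rewrite addnS /= {1}phiE.
pose lim s := phi (size s).+1 s.
have limE J s : size s < J -> phi J s = lim s.
  move=> sJ; have [th [_ thJ phiE]] := phiD (size s).+1 (J - (size s).+1).
  by rewrite -(subnKC sJ) phiE /= thJ.
exists lim; split.
  move=> k; apply: (@eq_strong_below _ _ _ (phi k)) (sphi k k) => s; exact: limE.
move=> e e' se se' ee'; pose J := top_level m e.
(* [K] bounds the lengths of all relevant nodes of [e] and [e'], so stage [J.+1 + K] agrees with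
   [lim] on them. It factors through stage [J.+1], where the extensions of [e] are settled. *)
pose K := maxn (size (e (nseq m false))) (size (e' (nseq m false))).
have limK e1 : strong_below n m.+1 c e1 -> size (e1 (nseq m false)) <= K ->
    chi (lim \o e1) = chi (phi (J.+1 + K) \o e1).
  move=> se1 e1K; apply: chi_ext => s sm; rewrite [RHS]limE //.
  apply: (@leq_ltn_trans K); last by rewrite addSn ltnS leq_addl.
  by apply: leq_trans e1K; apply: (strong_leq se1); rewrite size_nseq.
rewrite !limK ?leq_maxl ?leq_maxr //.
have [th [sth thJ ->]] := phiD J.+1 K.
have [_ _ /(_ e)] := PsiP (J, phi J); apply=> //.
- exact: strong_belowW se.
- exact: strong_comp.
- exact: strong_comp.
- move=> s sm /=; apply: thJ; apply: ltnW.
  exact: (size_below_top (strong_belowW (leqnSn m) se)).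
- move=> s sm /=; rewrite -ee' //; apply: thJ; apply: ltnW.
  exact: (size_below_top (strong_belowW (leqnSn m) se)).
Qed.

End Fusion.

(** Induction on the height: after [fusion] the last level no longer affects the colour, so
    evaluating it on one canonical extension [ext e] gives a colouring for height [m]. *)
Theorem milliken m c (chi : (seq bool -> seq bool) -> C) :
    depends_below_on m chi ->
  exists phi k, strong n phi /\
    forall e, strong_below n m c e -> chi (phi \o e) = k.
Proof.
elim: m chi => [|m IH] chi chi_ext.
  exists id, (chi id); split; first exact: strong_id.
  by move=> e _; apply: chi_ext.
have [phi [sphi phiP]] := fusion c chi_ext.
(* The total length is [c (size s)] plus [n] times the length of [succ_of e s], so it has the
   prescribed residue. *)
pose pad e s := succ_of e s ++ nseq (c (size s) + size (succ_of e s) * n.-1) false.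
pose ext e s := if size s < m then e s else pad e s.
have ext_strong e : strong_below n m c e -> strong_below n m.+1 c (ext e).
  move=> se s sm; have eqm : agree_below m e (ext e) by move=> t tm; rewrite /ext tm.
  have [ltm|gem] := ltnP (size s) m.
    have [] := eq_strong_below eqm se ltm; split=> //.
  have {gem}sm : size s = m by apply/eqP; rewrite eqn_leq gem -ltnS sm.
  split.
  - rewrite -(eq_succ_of eqm) ?sm // /ext sm ltnn; exact: prefix_prefix.
  - rewrite /ext sm ltnn size_cat size_nseq addnCA -mulnS prednK //.
    by rewrite sm addnC modnMDl.
  - move=> t; rewrite sm => tm; rewrite /ext sm tm ltnn !size_cat !size_nseq.
    by rewrite !(size_succ_of se) // sm tm.
have [|psi [k [spsi psiP]]] := IH (fun e => chi (phi \o ext e)).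
  move=> e e' ee'; apply: chi_ext => s sm /=; congr phi; rewrite /ext.
  by case: ifP => [/ee'//|_]; rewrite /pad (eq_succ_of ee').
exists (phi \o psi), k; split; first exact: strong_comp_strong.
move=> e se; have spe := strong_comp spsi (strong_belowW (leqnSn m) se).
rewrite -(psiP e (strong_belowW (leqnSn m) se)).
apply: phiP; [exact: strong_comp|exact: ext_strong|].
by move=> s sm; rewrite /ext sm.
Qed.

End Milliken.

(** * Envelopes *)

(** If [x] and [y] split, elements of [A] above them split at the same node, so one round of meets
    closes [A]. *)
Lemma in_meets_meet (A : {fset seq bool}) x y :
  in_meets A x -> in_meets A y -> in_meets A (meet x y).
Proof.
move=> Ax Ay; have [s [t [sA [_ stx]]]] := Ax; have [u [v [uA [_ uvy]]]] := Ay.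
have [xy|yx|r b rx ry] := meetP x y.
- by rewrite meet_prefix.
- by rewrite meetC meet_prefix.
exists s, u; do 2!split=> //; rewrite (meet_split rx ry).
have xs : prefix x s by rewrite -stx meet_prefixl.
have yu : prefix y u by rewrite -uvy meet_prefixl.
exact: meet_split (prefix_trans rx xs) (prefix_trans ry yu).
Qed.

Section Envelope.
Variables (n : nat) (M : seq (seq bool)).
Implicit Types (x y : seq bool) (i j : nat).

Definition levels : seq nat := sort leq (undup [seq size x | x <- M]).

Definition rank x := index (size x) levels.

(* The node of the full tree corresponding to [x] when the levels of [M] are
   renumbered consecutively. *)
Definition position x : seq bool := [seq nth false x l | l <- take (rank x) levels].

Lemma mem_levels x : x \in M -> size x \in levels.
Proof. by move=> xM; rewrite mem_sort mem_undup map_f. Qed.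

Lemma rank_ltn x : x \in M -> rank x < size levels.
Proof. by move=> xM; rewrite index_mem mem_levels. Qed.

Lemma nth_rank x : x \in M -> nth 0 levels (rank x) = size x.
Proof. by move=> xM; rewrite nth_index ?mem_levels. Qed.

Lemma nth_levels_ltn i j : i < j -> j < size levels ->
  nth 0 levels i < nth 0 levels j.
Proof.
move=> ij jl; apply: (sorted_ltn_nth ltn_trans) => //; last first.
  by rewrite inE (ltn_trans ij).
rewrite ltn_sorted_uniq_leq sort_uniq undup_uniq; exact: (sort_sorted leq_total).
Qed.

Lemma size_position x : x \in M -> size (position x) = rank x.
Proof. by move=> xM; rewrite size_map size_takel // ltnW ?rank_ltn. Qed.

Lemma nth_position x i : x \in M -> i < rank x ->
  nth false (position x) i = nth false x (nth 0 levels i).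
Proof.
move=> xM ix; rewrite (nth_map 0) ?nth_take //.
by rewrite size_takel // ltnW ?rank_ltn.
Qed.

Hypothesis M_meet : forall x y, x \in M -> y \in M -> meet x y \in M.
Variable g : seq bool -> seq bool.
Hypothesis g_prefix : forall x y,
  x \in M -> y \in M -> prefix x y -> prefix (g x) (g y).
Hypothesis g_size : forall x y, x \in M -> y \in M ->
  (size x < size y) = (size (g x) < size (g y)).
Hypothesis g_nth : forall x y, x \in M -> y \in M -> size x < size y ->
  nth false y (size x) = nth false (g y) (size (g x)).
Hypothesis g_mod : forall x, x \in M -> size (g x) = size x %[mod n].

Let repr i := nth [::] M (find (fun x => size x == nth 0 levels i) M).

Let glevel i := size (g (repr i)).

Local Lemma reprP i : i < size levels -> repr i \in M /\ size (repr i) = nth 0 levels i.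
Proof.
move=> il; have : nth 0 levels i \in levels by exact: mem_nth.
rewrite mem_sort mem_undup => /mapP[x xM lx].
have hasM : has (fun x => size x == nth 0 levels i) M.
  by apply/hasP; exists x; rewrite ?lx.
by split; [rewrite mem_nth // -has_find|apply/eqP; exact: (nth_find [::] hasM)].
Qed.

Local Lemma glevel_rank x : x \in M -> size (g x) = glevel (rank x).
Proof.
move=> xM; have [rM rx] := reprP (rank_ltn xM); rewrite nth_rank // in rx.
apply/eqP; rewrite /glevel eqn_leq.
by apply/andP; split; rewrite leqNgt -g_size // rx ltnn.
Qed.

Local Lemma glevel_ltn i j : i < j -> j < size levels -> glevel i < glevel j.
Proof.
move=> ij jl; have [iM ri] := reprP (ltn_trans ij jl); have [jM rj] := reprP jl.
by rewrite /glevel -g_size // ri rj nth_levels_ltn.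
Qed.

Local Lemma glevel_leq i j : i <= j -> j < size levels -> glevel i <= glevel j.
Proof. by rewrite leq_eqVlt => /predU1P[->//|ij] jl; apply/ltnW/glevel_ltn. Qed.

Local Lemma take_prefix i s t : prefix s t -> i <= size s ->
  take i t = take i s :> seq bool.
Proof. by case/prefixP=> u -> si; rewrite takel_cat. Qed.

(** If the meet has rank at least [i], its image contains the common initial part. Otherwise [x] and
    [y] would split at a rank below [i], where their positions would then differ. *)
Local Lemma coherent x y i : x \in M -> y \in M -> i <= rank x -> i <= rank y ->
    take i (position x) = take i (position y) ->
  take (glevel i) (g x) = take (glevel i) (g y).
Proof.
move=> xM yM ix iy xy; have zM := M_meet xM yM.
have [iz|zi] := leqP i (rank (meet x y)).
  have zi : glevel i <= size (g (meet x y)).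
    by rewrite glevel_rank // glevel_leq // rank_ltn.
  rewrite !(take_prefix (g_prefix _ _ _) zi) //; first exact: meet_prefixr.
  exact: meet_prefixl.
have [pxy|pyx|r b rx ry] := meetP x y.
- by move: zi; rewrite meet_prefix // ltnNge ix.
- by move: zi; rewrite meetC meet_prefix // ltnNge iy.
have zr := meet_split rx ry.
have nth_r t b' : prefix (rcons r b') t -> nth false t (size r) = b'.
  by case/prefixP=> u ->; rewrite nth_cat size_rcons leqnn nth_rcons ltnn eqxx.
have := congr1 (fun s => nth false s (rank r)) xy; rewrite -zr !nth_take //.
rewrite !nth_position ?(leq_trans zi) // nth_rank // zr (nth_r _ _ rx) (nth_r _ _ ry).
by case: (b).
Qed.

Let covers (p : seq bool) x := (size p <= rank x) && (take (size p) (position x) == p).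

(** The word is reversed because nodes grow at their end. On initial parts of positions [g] forces
    the value, independently of the chosen element by [coherent]; elsewhere the required letter is
    padded with [false] up to the next level. *)
Let Fixpoint envelope_rev (r : seq bool) : seq bool :=
  let p := rev r in
  if has (covers p) M then take (glevel (size p)) (g (nth [::] M (find (covers p) M)))
  else if r is b :: r' then
    rcons (envelope_rev r') b ++ nseq (glevel (size r) - (glevel (size r')).+1) false
  else [::].

Let envelope p := envelope_rev (rev p).

Local Lemma envelope_covered p x : x \in M -> covers p x ->
  envelope p = take (glevel (size p)) (g x).
Proof.
move=> xM px; have hasM : has (covers p) M by apply/hasP; exists x.
have -> : envelope p = take (glevel (size p)) (g (nth [::] M (find (covers p) M))).
  have envE r : has (covers (rev r)) M -> envelope_rev r =
      take (glevel (size (rev r))) (g (nth [::] M (find (covers (rev r)) M))).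
    by case: r => [|b r] /= ->.
  by rewrite /envelope envE revK.
have yM : nth [::] M (find (covers p) M) \in M by rewrite mem_nth // -has_find.
have /andP[py /eqP yp] := nth_find [::] hasM; have /andP[px' /eqP xp] := px.
by apply: coherent => //; rewrite yp xp.
Qed.

Local Lemma envelope_uncovered q b : ~~ has (covers (rcons q b)) M ->
  envelope (rcons q b) =
  rcons (envelope q) b ++ nseq (glevel (size q).+1 - (glevel (size q)).+1) false.
Proof.
by move=> /negPf nhas; rewrite /envelope rev_rcons /= -rev_rcons revK nhas size_rev.
Qed.

Local Lemma size_envelope p : size p < size levels ->
  size (envelope p) = glevel (size p).
Proof.
elim/last_ind: p => [|q b IH] pl.
  have [xM _] := reprP pl.
  have x0 : covers [::] (repr 0) by rewrite /covers /= take0 eqxx.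
  by rewrite (envelope_covered xM x0) /glevel take_size.
have [/hasP[x xM px]|nhas] := boolP (has (covers (rcons q b)) M).
  rewrite (envelope_covered xM px) size_takel // glevel_rank //.
  by rewrite glevel_leq ?rank_ltn //; case/andP: px.
rewrite size_rcons in pl *.
rewrite envelope_uncovered // size_cat size_rcons IH ?(ltnW pl) // size_nseq.
by rewrite subnKC // glevel_ltn.
Qed.

(** Positions and prescribed residues depend on [M] alone, so one application of [milliken] can
    handle every [g]. *)
Lemma envelope_exists : exists e,
  strong_below n (size levels) (nth 0 levels) e /\
  forall x, x \in M -> e (position x) = g x.
Proof.
exists envelope; split=> [p pl|x xM]; last first.
  have xx : covers (position x) x.
    by rewrite /covers size_position // leqnn -size_position // take_size eqxx.
  by rewrite (envelope_covered xM xx) size_position // -glevel_rank // take_size.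
split.
- elim/last_ind: p pl => [|q b _] pl; first exact: prefix0s.
  rewrite succ_of_rcons.
  have [/hasP[x xM px]|nhas] := boolP (has (covers (rcons q b)) M); last first.
    by rewrite envelope_uncovered // prefix_prefix.
  have /andP[qx /eqP xqb] := px; rewrite size_rcons in qx xqb pl.
  have xq : take (size q) (position x) = q.
    by rewrite -(take_takel _ (leqnSn _)) xqb -cats1 take_size_cat.
  have xb : nth false (position x) (size q) = b.
    by rewrite -(nth_take false (ltnSn (size q))) xqb nth_rcons ltnn eqxx.
  have qx' : covers q x by rewrite /covers xq eqxx ltnW.
  rewrite (envelope_covered xM px) (envelope_covered xM qx') size_rcons.
  have lt_glevel := glevel_ltn (ltnSn (size q)) pl.
  have [rM rq] := reprP (ltnW pl).
  have gx : glevel (size q).+1 <= size (g x).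
    by rewrite glevel_rank // glevel_leq // rank_ltn.
  (* The representative of level [size q] supplies an element of [M] of the right length for
     [g_nth]. *)
  have -> : b = nth false (g x) (glevel (size q)).
    rewrite -xb nth_position // -rq g_nth // rq -(nth_rank xM) nth_levels_ltn //.
    exact: rank_ltn.
  rewrite -take_nth; last exact: leq_trans gx.
  by rewrite -(take_takel _ lt_glevel) prefix_take.
- have [rM rp] := reprP pl.
  by rewrite size_envelope // /glevel g_mod // rp.
- by move=> t tp; rewrite !size_envelope ?tp.
Qed.

End Envelope.

(** * The infinite strong subtree enumerated by a strong embedding *)

Section Image.
Variables (n : nat) (phi : seq bool -> seq bool).
Hypothesis sphi : strong n phi.
Implicit Types s t : seq bool.

Definition image_pred : pred (seq bool) := fun t => `[< exists s, phi s = t >].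

Let phi_prefixE s t : prefix (phi s) (phi t) = prefix s t.
Proof.
by apply: (strong_prefixE (@sphi (maxn (size s) (size t)).+1));
   rewrite ltnS ?leq_maxl ?leq_maxr.
Qed.

Let phi_inj s t : phi s = phi t -> s = t.
Proof.
by apply: (strong_inj (@sphi (maxn (size s) (size t)).+1));
   rewrite ltnS ?leq_maxl ?leq_maxr.
Qed.

Let phi_rcons s b : prefix (rcons (phi s) b) (phi (rcons s b)).
Proof. exact: (strong_rcons (@sphi (size s).+2)). Qed.

Lemma image_predP s : image_pred (phi s).
Proof. by apply/asboolP; exists s. Qed.

Lemma strong_ltnE s t : (size (phi s) < size (phi t)) = (size s < size t).
Proof.
apply/idP/idP => [|st]; last exact: (strong_ltn (@sphi _) st (ltnSn _)).
by apply: contraLR; rewrite -!leqNgt => ts; exact: (strong_leq (@sphi _) ts (ltnSn _)).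
Qed.

(** Passing from [s] to [rcons s b] adds only [phi s] to the count: an image node strictly between
    would come from a [t] of length strictly between [size s] and [(size s).+1]. *)
Lemma lvl_image s : lvl image_pred (phi s) = size s.
Proof.
elim/last_ind: s => [|s b IH].
  rewrite /lvl (@eq_in_count _ _ pred0) ?count_pred0 // => i.
  rewrite mem_iota add0n /= => il; apply/asboolP => -[t tE].
  have : size (phi t) < size (phi [::]) by rewrite tE size_take il.
  by rewrite strong_ltnE.
have /prefixP[u phiE] := phi_rcons s b.
rewrite size_rcons -IH /lvl phiE size_cat size_rcons -addn1 -addnA iotaD count_cat.
rewrite add0n iotaD count_cat /= addn0.
have -> : take (size (phi s)) (rcons (phi s) b ++ u) = phi s.
  by rewrite cat_rcons take_size_cat.
rewrite image_predP.
rewrite [X in _ + (_ + X)](@eq_in_count _ _ pred0) ?count_pred0 ?addn0 => [|i].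
  rewrite addn1; congr _.+1; apply: eq_in_count => i.
  by rewrite mem_iota add0n /= => is_; rewrite cat_rcons takel_cat // ltnW.
rewrite mem_iota addn1 => /andP[si isu]; apply/asboolP => -[t tE].
have ti : size (phi t) = i.
  by rewrite tE size_takel // size_cat size_rcons ltnW.
have : size (phi s) < size (phi t) by rewrite ti.
rewrite strong_ltnE => st.
have : size (phi t) < size (phi (rcons s b)) by rewrite ti phiE size_cat size_rcons.
by rewrite strong_ltnE size_rcons ltnS leqNgt st.
Qed.

Lemma image_S_Sigma : S_Sigma n image_pred.
Proof.
split; [split; [|split]|split].
- exists (phi [::]); split; first exact: image_predP.
  by move=> _ /asboolP[s <-]; rewrite phi_prefixE prefix0s.
- move=> _ _ /asboolP[s <-] /asboolP[t <-]; rewrite !lvl_image => st.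
  exact: (strong_size (@sphi _) (ltnSn _)).
- move=> _ b /asboolP[s <-] _; exists (phi (rcons s b)).
  have sphi_neq : phi s != phi (rcons s b).
    apply/eqP => /phi_inj /(congr1 size); rewrite size_rcons => /eqP.
    by rewrite eqn_leq ltnn andbF.
  split; first split=> //; first split; [exact: image_predP|split|].
  + by rewrite /sprefix phi_prefixE prefix_rcons.
  + move=> _ /asboolP[t <-] /andP[st' st]; apply/negP => /andP[+ tsb].
    rewrite phi_prefixE => /prefix_rconsE[tE|ts]; first by rewrite tE eqxx in tsb.
    case/negP: st; apply/eqP; congr phi; rewrite phi_prefixE in st'.
    by apply: prefix_eq_size; rewrite ?size_prefix.
  + move=> _ [[/asboolP[t <-] [/andP[_ _] tmin]] sbt].
    have st : prefix s t.
      by rewrite -phi_prefixE; exact: prefix_trans (prefix_rcons _ _) sbt.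
    have lst : size s < size t.
      by rewrite -strong_ltnE -(size_rcons _ b) size_prefix.
    have rst := prefix_rcons_nth st lst.
    have rphi : prefix (rcons (phi s) (nth false t (size s))) (phi t).
      by apply: prefix_trans (phi_rcons _ _) _; rewrite phi_prefixE.
    rewrite (prefix_rcons_inj rphi sbt) in rst.
    have := tmin _ (image_predP (rcons s b)); rewrite /sprefix !phi_prefixE rst /=.
    by rewrite prefix_rcons sphi_neq => /(_ isT) /negPn /eqP.
- by move=> j; exists (phi (nseq j false)); rewrite lvl_image size_nseq image_predP.
- move=> _ /asboolP[s <-]; rewrite lvl_image /sigma.
  by have [_ -> _] := @sphi _ _ (ltnSn (size s)).
Qed.

End Image.

(** * Copies of a finite set in a strong subtree *)

Local Open Scope fset_scope.

Theorem theorem7 (n : nat) (hn : 0 < n) (A : {fset seq bool}) (k : nat) (hk : 0 < k)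
  (chi : {fset seq bool} -> 'I_k) :
  exists S : pred (seq bool), S_Sigma n S /\
    exists c : 'I_k, forall B : {fset seq bool},
      Em n A B -> (forall x, x \in B -> S x) -> chi B = c.
Proof.
pose M := [seq meet s t | s <- enum_fset A, t <- enum_fset A].
have MP x : reflect (in_meets A x) (x \in M).
  apply: (iffP allpairsP) => [[[s t] /= [sA tA ->]]|[s [t [sA [tA <-]]]]].
    by exists s, t.
  by exists (s, t).
have AM x : x \in A -> x \in M.
  by move=> xA; apply/MP; exists x, x; rewrite meet_prefix ?prefix_refl.
have M_meet x y : x \in M -> y \in M -> meet x y \in M.
  by move=> /MP xA /MP yA; apply/MP; exact: in_meets_meet.
(* Every copy of [A] in the final subtree will be [copy (phi \o e)] for a strong [e], so it suffices
   to colour embeddings. *)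
pose copy (e : seq bool -> seq bool) := [fset e (position M x) | x in A]%fset.
have copy_ext : depends_below_on (size (levels M)) (fun e => chi (copy e)).
  move=> e e' ee'; congr chi; apply: eq_in_imfset => // x /AM xM.
  by rewrite ee' // size_position // rank_ltn.
have [phi [c [sphi phiP]]] := milliken hn (nth 0 (levels M)) copy_ext.
exists (image_pred phi); split; first exact: image_S_Sigma.
exists c => B [f [fB [f_inj [f_surj fP]]]] BS.
have meet_image x : in_meets B x -> exists s, phi s = x.
  case=> _ [_ [/BS /asboolP[s <-] [/BS /asboolP[t <-] <-]]]; exists (meet s t).
  rewrite (strong_meet (sphi (maxn (size s) (size t)).+1)) // ltnS.
    exact: leq_maxl.
  exact: leq_maxr.
(* The meets of [B] also lie in the image of [phi], so the [Em] bijection [f] lifts through [phi] to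
   [g]. *)
have /choice[g gP] x : exists s, x \in M -> phi s = f x.
  have [/MP xM|] := boolP (x \in M); last by exists [::].
  by have [s sx] := meet_image _ (fB x xM); exists s.
have fPM x y : x \in M -> y \in M -> [/\ prefix x y = prefix (g x) (g y),
    (size x < size y) = (size (g x) < size (g y)),
    size x < size y -> nth false y (size x) = nth false (g y) (size (g x)) &
    size (g x) = size x %[mod n]].
  move=> xM yM; have [fpre fsize _ fnth] := fP x y (elimT (MP x) xM) (elimT (MP y) yM).
  have sg : (size x < size y) = (size (g x) < size (g y)).
    by rewrite fsize -!gP // (strong_ltnE sphi).
  rewrite /sigma !addn1 => -[fmod]; split=> //.
  - rewrite fpre -!gP // (strong_prefixE (sphi (maxn (size (g x)) (size (g y))).+1)) //.
      by rewrite ltnS leq_maxl.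
    by rewrite ltnS leq_maxr.
  - move=> xy; rewrite fnth // -!gP //.
    by rewrite (strong_nth (sphi (size (g y)).+1)) // -sg.
  - by have [_ /= <- _] := sphi _ (g x) (ltnSn _); rewrite gP.
have [x y xM yM xy|x y xM yM|x y xM yM xy|x xM|e [se eP]] :=
    @envelope_exists n M M_meet g.
- by have [<-] := fPM x y xM yM.
- by have [_ ->] := fPM x y xM yM.
- by have [_ _ ->] := fPM x y xM yM.
- by have [_ _ _ ->] := fPM x x xM xM.
(* [copy (phi \o e)] is the image of [A] under [f], which is all of [B] because [f] preserves and
   reflects membership. *)
rewrite -(phiP e se) /=; congr chi; apply/fsetP => y; apply/idP/imfsetP => /=.
  move=> yB; have [|x [xA fxy]] := f_surj y.
    by exists y, y; rewrite meet_prefix ?prefix_refl.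
  have xM : x \in M by apply/MP.
  exists x; last by rewrite eP // gP.
  by have [_ _ -> _] := fP x x xA xA; rewrite fxy.
move=> [x xA ->]; have xM := AM x xA; rewrite eP // gP //.
by have [_ _ <- _] := fP x x (elimT (MP x) xM) (elimT (MP x) xM).
Qed.
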